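(* Let $p$ be a prime. For $x,y,z\in\mathbb{Z}/p\mathbb{Z}$ with $xyz\neq 0$, let $R_{x,y,z}\colon W\to\mathbb{C}$ be the linear functional \[ R_{x,y,z}(f)=f(1:x:y)+f(1:y:z)+f(1:z:x)-f\!\left(1:\tfrac{y}{x}:\tfrac{z}{x}\right). \] Then $R_{x,y,z}$ annihilates $W^{\mathrm{nc}}$, i.e. $R_{x,y,z}(g)=0$ for every $g\in W^{\mathrm{nc}}$.
   Context: Let $p$ be a prime. $W$ denotes the complex vector space of functions $f\colon\mathbb{P}^2(\mathbb{Z}/p\mathbb{Z})\to\mathbb{C}$ satisfying (i) $f(x:y:z)=f(z:x:y)=f(-x:y:z)=-f(y:x:z)$ and (ii) $f(x:y:z)+f(-y:x-y:z)+f(y-x:-x:z)=0$ for all points. $W_0$ denotes the complex vector space of functions $f\colon\mathbb{P}^1(\mathbb{Z}/p\mathbb{Z})\to\mathbb{C}$ satisfying (i) $f(x:y)=f(-x:y)=-f(y:x)$, (ii) $f(x:y)+f(-y:x-y)+f(y-x:-x)=0$, (iii) $f(1:0)=0$. For $f\in W_0$ set $f(0:0)=0$, and define linear maps $\alpha,\beta\colon W_0\to W$ by $(\alpha f)(x:y:z)=f(x:y)+f(y:z)+f(z:x)$, and $(\beta f)(x:y:z)=0$ if $xyz\neq0$, $=f(x:y)$ if $z=0$, $=f(y:z)$ if $x=0$, $=f(z:x)$ if $y=0$. Define $W^{\mathrm{nc}}=\alpha(W_0)+\beta(W_0)\subseteq W$. (Here $W$ is isomorphic to $H_3(\Gamma_0(3,p),\mathbb{C})$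 and $W^{\mathrm{nc}}$ corresponds to the non-cuspidal part; the functional $R_{x,y,z}$ is the pairing with the combination of unimodular symbols $[Q_{x,y}]+[Q_{y,z}]+[Q_{z,x}]-[Q_{y/x,z/x}]$, where $Q_{a,b}$ is the matrix with rows $(1,0,0),(a,1,0),(b,0,1)$ and $[Q](f)$ is $f$ evaluated at the first column of $Q$.) *)

(* Defs.v *)
From HB Require Import structures.
From mathcomp Require Import all_boot all_algebra.
From mathcomp Require Import reals complex ring.

Set Implicit Arguments.
Unset Strict Implicit.
Unset Printing Implicit Defensive.

Import GRing.Theory.
Local Open Scope ring_scope.
Local Open Scope quotient_scope.
Local Open Scope complex_scope.

Section ProjectiveSpace.
Context (F : finFieldType) (n : nat).

Definition nzvec := {v : 'rV[F]_n.+1 | v != 0}.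

Definition proportional (u v : nzvec) : bool :=
  [exists a : F, (a != 0) && (val u == a *: val v)].

Lemma proportional_refl : reflexive proportional.
Proof. by move=> u; apply/existsP; exists 1; rewrite oner_eq0 scale1r eqxx. Qed.

Lemma proportional_sym : symmetric proportional.
Proof.
suff H u v : proportional u v -> proportional v u by move=> u v; apply/idP/idP; exact: H.
case/existsP=> a /andP[a0 /eqP E]; apply/existsP; exists a^-1.
by rewrite invr_eq0 a0 E scalerA mulVf // scale1r eqxx.
Qed.

Lemma proportional_trans : transitive proportional.
Proof.
move=> v u w /existsP[a /andP[a0 /eqP E]] /existsP[b /andP[b0 /eqP E']].
by apply/existsP; exists (a * b); rewrite mulf_neq0 // E E' scalerA eqxx.
Qed.

Canonical proportional_equiv :=
  EquivRel proportional proportional_refl proportional_sym proportional_trans.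

Definition proj := {eq_quot proportional}.
HB.instance Definition _ := EqQuotient.on proj.
HB.instance Definition _ := Countable.copy proj (quot_type proj).
HB.instance Definition _ : isFinite proj :=
  CanIsFinite (@reprK _ proj).

(* K^o makes these functions a K-module. *)
Context (K : nzRingType).
Implicit Types (f g : {ffun proj -> K^o}) (v : 'rV[F]_n.+1).

(* Value of f at the point with homogeneous coordinates v, extended by the
   value 0 at v = 0, where there is no such point. *)
Definition hval f v : K :=
  if insub v is Some u then f (\pi_proj (u : nzvec)) else 0.

Lemma hval0 f : hval f 0 = 0.
Proof. by rewrite /hval insubF ?eqxx. Qed.

Lemma hval_val f (u : nzvec) : hval f (val u) = f (\pi_proj u).
Proof. by rewrite /hval valK. Qed.

Lemma hvalZ f a v : a != 0 -> hval f (a *: v) = hval f v.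
Proof.
move=> a0; have [->|v0] := eqVneq v 0; first by rewrite scaler0.
have av0 : a *: v != 0 by rewrite scaler_eq0 negb_or a0.
rewrite -[v in RHS]/(val (Sub v v0 : nzvec)).
rewrite -[a *: v]/(val (Sub (a *: v) av0 : nzvec)) !hval_val.
congr (f _); apply/eqmodP; apply/existsP; exists a.
by rewrite a0 /= eqxx.
Qed.

Lemma hvalD f g v : hval (f + g) v = hval f v + hval g v.
Proof. by rewrite /hval; case: insub => [u|]; rewrite ?ffunE ?addr0. Qed.

Lemma hvalZl c f v : hval (c *: f) v = c * hval f v.
Proof. by rewrite /hval; case: insub => [u|]; rewrite ?ffunE ?mulr0. Qed.

Lemma hval_zero v : hval 0 v = 0.
Proof. by rewrite /hval; case: insub => [u|] //; rewrite ffunE. Qed.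

End ProjectiveSpace.

(* hval2 f x y is f(x:y) and hval3 f x y z is f(x:y:z); in particular
   f(0:0) = 0. *)
Definition hval2 (F : finFieldType) (K : nzRingType) (f : {ffun proj F 1 -> K^o})
  (x y : F) : K := hval f (\row_(i < 2) [:: x; y]`_i).

Definition hval3 (F : finFieldType) (K : nzRingType) (f : {ffun proj F 2 -> K^o})
  (x y z : F) : K := hval f (\row_(i < 3) [:: x; y; z]`_i).

Section Coordinates.
Context (F : finFieldType) (K : nzRingType).

Lemma hval2_00 (f : {ffun proj F 1 -> K^o}) : hval2 f 0 0 = 0.
Proof.
rewrite -[RHS](hval0 f); congr hval; apply/rowP => i; rewrite !mxE.
by case: i => [[|[|k]] ?] /=; rewrite ?nth_nil ?mulr0.
Qed.

Lemma hval3_000 (f : {ffun proj F 2 -> K^o}) : hval3 f 0 0 0 = 0.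
Proof.
rewrite -[RHS](hval0 f); congr hval; apply/rowP => i; rewrite !mxE.
by case: i => [[|[|[|k]]] ?] /=; rewrite ?nth_nil ?mulr0.
Qed.

Lemma hval2Z (f : {ffun proj F 1 -> K^o}) a x y :
  a != 0 -> hval2 f (a * x) (a * y) = hval2 f x y.
Proof.
move=> a0; rewrite /hval2 -[RHS](hvalZ f _ a0); congr hval; apply/rowP => i.
by rewrite !mxE; case: i => [[|[|k]] ?] /=; rewrite ?nth_nil ?mulr0.
Qed.

Lemma hval3Z (f : {ffun proj F 2 -> K^o}) a x y z :
  a != 0 -> hval3 f (a * x) (a * y) (a * z) = hval3 f x y z.
Proof.
move=> a0; rewrite /hval3 -[RHS](hvalZ f _ a0); congr hval; apply/rowP => i.
by rewrite !mxE; case: i => [[|[|[|k]]] ?] /=; rewrite ?nth_nil ?mulr0.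
Qed.

Lemma hval2D (f g : {ffun proj F 1 -> K^o}) x y :
  hval2 (f + g) x y = hval2 f x y + hval2 g x y.
Proof. exact: hvalD. Qed.

Lemma hval3D (f g : {ffun proj F 2 -> K^o}) x y z :
  hval3 (f + g) x y z = hval3 f x y z + hval3 g x y z.
Proof. exact: hvalD. Qed.

Lemma hval2Zl c (f : {ffun proj F 1 -> K^o}) x y :
  hval2 (c *: f) x y = c * hval2 f x y.
Proof. exact: hvalZl. Qed.

Lemma hval3Zl c (f : {ffun proj F 2 -> K^o}) x y z :
  hval3 (c *: f) x y z = c * hval3 f x y z.
Proof. exact: hvalZl. Qed.

(* The function on P^2 with (x:y:z) |-> h x y z, for h homogeneous of degree 0. *)
Definition of_coords (h : F -> F -> F -> K) : {ffun proj F 2 -> K^o} :=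
  [ffun P : proj F 2 => let v := val (repr P) in h (v 0 0) (v 0 (inord 1)) (v 0 (inord 2))].

Lemma of_coordsE h :
    (forall a x y z, a != 0 -> h (a * x) (a * y) (a * z) = h x y z) ->
    h 0 0 0 = 0 ->
  forall x y z, hval3 (of_coords h) x y z = h x y z.
Proof.
move=> hZ h0 x y z; rewrite /hval3; set v := \row_i _.
have [v0|v0] := eqVneq v 0.
  have E i : v 0 i = 0 by rewrite v0 mxE.
  move: (E 0) (E (inord 1)) (E (inord 2)); rewrite !mxE !inordK //= => -> -> ->.
  by rewrite v0 hval0 h0.
rewrite -[v]/(val (Sub v v0 : nzvec F 2)) hval_val ffunE /=.
set u := repr _.
have /eqmodP/existsP[a /andP[a0 /eqP E]] :
  u = Sub v v0 %[mod proj F 2] by rewrite reprK.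
by rewrite E !mxE !inordK //= hZ.
Qed.

End Coordinates.

Section Spaces.
Context (R : realType) (p : nat).

(* The relations below also hold for zero coordinates, so there is no need to
   exclude them. *)
Definition W_pred : {pred {ffun proj 'F_p 2 -> R[i]^o}} :=
  fun f => [forall x, forall y, forall z,
    [&& hval3 f x y z == hval3 f z x y,
        hval3 f x y z == hval3 f (- x) y z,
        hval3 f x y z == - hval3 f y x z &
        hval3 f x y z + hval3 f (- y) (x - y) z
          + hval3 f (y - x) (- x) z == 0]].

Definition W0_pred : {pred {ffun proj 'F_p 1 -> R[i]^o}} :=
  fun f => [forall x, forall y,
    [&& hval2 f x y == hval2 f (- x) y,
        hval2 f x y == - hval2 f y x &
        hval2 f x y + hval2 f (- y) (x - y) + hval2 f (y - x) (- x) == 0]]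
    && (hval2 f 1 0 == 0).

Lemma W_predP f : reflect
  (forall x y z,
    [/\ hval3 f x y z = hval3 f z x y,
        hval3 f x y z = hval3 f (- x) y z,
        hval3 f x y z = - hval3 f y x z &
        hval3 f x y z + hval3 f (- y) (x - y) z
          + hval3 f (y - x) (- x) z = 0])
  (f \in W_pred).
Proof.
apply: (iffP idP) => [H x y z|H].
  by have /and4P[/eqP ? /eqP ? /eqP ? /eqP ?] := forallP (forallP (forallP H x) y) z.
apply/forallP => x; apply/forallP => y; apply/forallP => z.
by have [? ? ? ?] := H x y z; apply/and4P; split; apply/eqP.
Qed.

Lemma W0_predP f : reflect
  ((forall x y,
    [/\ hval2 f x y = hval2 f (- x) y,
        hval2 f x y = - hval2 f y x &
        hval2 f x y + hval2 f (- y) (x - y) + hval2 f (y - x) (- x) = 0])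
   /\ hval2 f 1 0 = 0)
  (f \in W0_pred).
Proof.
apply: (iffP andP) => -[H /eqP H0]; split=> //.
  by move=> x y; have /and3P[/eqP ? /eqP ? /eqP ?] := forallP (forallP H x) y.
apply/forallP => x; apply/forallP => y.
by have [? ? ?] := H x y; apply/and3P; split; apply/eqP.
Qed.

Lemma W_submod_closed : submod_closed W_pred.
Proof.
split=> [|c f g /W_predP Hf /W_predP Hg]; apply/W_predP.
  by move=> x y z; rewrite /hval3 !hval_zero oppr0 !addr0; split.
move=> x y z; rewrite !hval3D !hval3Zl.
have [f1 f2 f3 f4] := Hf x y z; have [g1 g2 g3 g4] := Hg x y z.
split; rewrite -?f1 -?g1 -?f2 -?g2 //; first by rewrite f3 g3; ring.
transitivity (c * 0 + 0 : R[i]); last by rewrite mulr0 addr0.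
by rewrite -{1}f4 -g4; ring.
Qed.
HB.instance Definition _ := GRing.isSubmodClosed.Build R[i] _ W_pred W_submod_closed.

Lemma W0_submod_closed : submod_closed W0_pred.
Proof.
split=> [|c f g /W0_predP[Hf f0] /W0_predP[Hg g0]]; apply/W0_predP.
  by rewrite /hval2 !hval_zero; split=> // x y; rewrite !hval_zero oppr0 !addr0.
split=> [x y|]; rewrite !hval2D !hval2Zl; last by rewrite f0 g0 mulr0 addr0.
have [f1 f2 f3] := Hf x y; have [g1 g2 g3] := Hg x y.
split; rewrite -?f1 -?g1 //; first by rewrite f2 g2; ring.
transitivity (c * 0 + 0 : R[i]); last by rewrite mulr0 addr0.
by rewrite -{1}f3 -g3; ring.
Qed.
HB.instance Definition _ := GRing.isSubmodClosed.Build R[i] _ W0_pred W0_submod_closed.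

Record W := MkW { W_fun :> {ffun proj 'F_p 2 -> R[i]^o}; _ : W_fun \in W_pred }.
HB.instance Definition _ := [isSub for W_fun].
HB.instance Definition _ := [Choice of W by <:].
HB.instance Definition _ := [SubChoice_isSubLmodule of W by <:].

Record W0 := MkW0 { W0_fun :> {ffun proj 'F_p 1 -> R[i]^o}; _ : W0_fun \in W0_pred }.
HB.instance Definition _ := [isSub for W0_fun].
HB.instance Definition _ := [Choice of W0 by <:].
HB.instance Definition _ := [SubChoice_isSubLmodule of W0 by <:].

Section Rules.
Variable f : W0.
Let H := elimT (W0_predP f) (valP f).

Lemma W0N1 x y : hval2 f (- x) y = hval2 f x y. Proof. by have [->] := H.1 x y. Qed.
Lemma W0C x y : hval2 f x y = - hval2 f y x. Proof. by have [_ ->] := H.1 x y. Qed.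
Lemma W0N2 x y : hval2 f x (- y) = hval2 f x y.
Proof. by rewrite W0C W0N1 -W0C. Qed.
Lemma W03 x y : hval2 f x y + hval2 f (- y) (x - y) + hval2 f (y - x) (- x) = 0.
Proof. by have [_ _ ->] := H.1 x y. Qed.
Lemma W0x0 x : hval2 f x 0 = 0.
Proof.
have [->|x0] := eqVneq x 0; first exact: hval2_00.
by rewrite -[x]mulr1 -[X in hval2 _ _ X](mulr0 x) hval2Z // H.2.
Qed.
Lemma W00x x : hval2 f 0 x = 0. Proof. by rewrite W0C W0x0 oppr0. Qed.
End Rules.

Definition alpha_fun (f : W0) : {ffun proj 'F_p 2 -> R[i]^o} :=
  of_coords (fun x y z => hval2 f x y + hval2 f y z + hval2 f z x).

(* When several coordinates vanish, all the applicable values agree (they are 0,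
   as f(1:0) = f(0:1) = 0), so the order of the tests is irrelevant: see betaE. *)
Definition beta_fun (f : W0) : {ffun proj 'F_p 2 -> R[i]^o} :=
  of_coords (fun x y z =>
    if x * y * z != 0 then 0
    else if z == 0 then hval2 f x y
    else if x == 0 then hval2 f y z
    else hval2 f z x).

Lemma alpha_funE f x y z :
  hval3 (alpha_fun f) x y z = hval2 f x y + hval2 f y z + hval2 f z x.
Proof.
rewrite of_coordsE // => [a {}x {}y {}z a0|]; first by rewrite !hval2Z.
by rewrite hval2_00 !addr0.
Qed.

Lemma beta_funE f x y z :
  hval3 (beta_fun f) x y z =
    if x * y * z != 0 then 0
    else if z == 0 then hval2 f x y
    else if x == 0 then hval2 f y z
    else hval2 f z x.
Proof.
rewrite of_coordsE // => [a {}x {}y {}z a0|]; last first.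
  by rewrite mulr0 eqxx hval2_00.
by rewrite !mulf_eq0 !(negPf a0) /= !hval2Z.
Qed.

Lemma alpha_in_W f : alpha_fun f \in W_pred.
Proof.
apply/W_predP => x y z; rewrite !alpha_funE; split.
- by ring.
- by rewrite W0N1 W0N2.
- by rewrite (W0C _ y x) (W0C _ x z) (W0C _ z y); ring.
- rewrite -[RHS](W03 f x y) !W0N1 !W0N2 (W0C _ z y) (W0C _ (x - y) z).
  by rewrite -[hval2 f z (x - y)]W0N2 opprB (W0C _ z x); ring.
Qed.

Lemma beta_in_W f : beta_fun f \in W_pred.
Proof.
have x0 := W0x0 f; have ox := W00x f.
apply/W_predP => x y z; rewrite !beta_funE !mulf_eq0 !oppr_eq0 !subr_eq0.
split.
- case: (eqVneq x 0) => [?|_]; case: (eqVneq y 0) => [?|_];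
  case: (eqVneq z 0) => [?|_]; subst; by rewrite /= ?x0 ?ox.
- case: (eqVneq x 0) => [?|_]; case: (eqVneq y 0) => [?|_];
  case: (eqVneq z 0) => [?|_]; subst;
  by rewrite /= ?oppr0 ?W0N1 ?W0N2 ?x0 ?ox.
- case: (eqVneq x 0) => [?|_]; case: (eqVneq y 0) => [?|_];
  case: (eqVneq z 0) => [?|_]; subst; rewrite /= ?x0 ?ox ?oppr0 //; exact: W0C.
- case: (eqVneq z 0) => [?|zn]; first by rewrite !orbT /= W03.
  case: (eqVneq x 0) => [?|xn]; case: (eqVneq y 0) => [?|yn]; subst => /=.
  + by rewrite ?eqxx /= ?(subr0, oppr0) !(x0, ox) !addr0.
  + rewrite (eq_sym 0 y) (negPf yn) /= subr0 addr0.
    by rewrite (W0C _ y z) addNr.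
  + rewrite (eq_sym 0 x) (negPf xn) /= subr0 addr0.
    by rewrite (W0C _ z x) addNr.
  + rewrite (eq_sym y x); case: (eqVneq x y) => [?|_]; subst;
      rewrite /= ?addr0 ?add0r //.
    by rewrite !W0N2 !W0N1 (W0C _ z y) addNr.
Qed.

Definition alpha (f : W0) : W := MkW (alpha_in_W f).
Definition beta (f : W0) : W := MkW (beta_in_W f).

Lemma alphaE f x y z :
  hval3 (alpha f) x y z = hval2 f x y + hval2 f y z + hval2 f z x.
Proof. exact: alpha_funE. Qed.

Lemma betaE f x y z :
  [/\ x * y * z != 0 -> hval3 (beta f) x y z = 0,
      z = 0 -> hval3 (beta f) x y z = hval2 f x y,
      x = 0 -> hval3 (beta f) x y z = hval2 f y z &
      y = 0 -> hval3 (beta f) x y z = hval2 f z x].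
Proof.
rewrite beta_funE; split=> [->|->|->|->] //; rewrite ?mulr0 ?mul0r ?eqxx //=.
  by case: eqP => // ->; rewrite W0x0 W00x.
by case: eqP => [->|_]; [rewrite W0x0 W00x | case: eqP => // ->; rewrite W0x0 W00x].
Qed.

Lemma of_coords_linear (h h1 h2 : 'F_p -> 'F_p -> 'F_p -> R[i]) c :
  (forall x y z, h x y z = c * h1 x y z + h2 x y z) ->
  of_coords h = c *: of_coords h1 + of_coords h2.
Proof. by move=> E; apply/ffunP => P; rewrite !ffunE /= E. Qed.

Lemma alpha_linear : linear alpha.
Proof.
move=> c f g; apply: val_inj => /=; apply: of_coords_linear => x y z.
by rewrite !hval2D !hval2Zl; ring.
Qed.
HB.instance Definition _ := GRing.isLinear.Build R[i] W0 W _ alpha alpha_linear.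

Lemma beta_linear : linear beta.
Proof.
move=> c f g; apply: val_inj => /=; apply: of_coords_linear => x y z.
by rewrite !hval2D !hval2Zl; do !case: ifP => _ //; rewrite mulr0 addr0.
Qed.
HB.instance Definition _ := GRing.isLinear.Build R[i] W0 W _ beta beta_linear.

Definition Wnc (g : W) : Prop := exists f1 f2 : W0, g = alpha f1 + beta f2.

Definition Rxyz (x y z : 'F_p) (f : W) : R[i] :=
  hval3 f 1 x y + hval3 f 1 y z + hval3 f 1 z x - hval3 f 1 (y / x) (z / x).

Lemma Rxyz_linear x y z : scalar (Rxyz x y z).
Proof. by move=> c f g; rewrite /Rxyz !hval3D !hval3Zl; ring. Qed.
HB.instance Definition _ x y z :=
  GRing.isLinear.Build R[i] W R[i] _ (Rxyz x y z) (Rxyz_linear x y z).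

End Spaces.

(* Main.v *)
Require Import Defs.
From mathcomp Require Import all_boot all_algebra.
From mathcomp Require Import reals complex ring.

Import GRing.Theory.
Local Open Scope ring_scope.

(** By linearity, [alpha f] and [beta f] can be treated separately. In [Rxyz_alpha], the values at
    (1:t) and (t:1), for t = x, y, z, cancel by antisymmetry; what remains is a cyclic sum over x,
    y, z, equal to the subtracted term by homogeneity. In [Rxyz_beta], all four points lie off the
    coordinate lines, where [beta f] vanishes. *)

Lemma Rxyz_alpha (R : realType) (p : nat) (x y z : 'F_p) (f : W0 R p) :
  x != 0 -> Rxyz x y z (alpha f) = 0.
Proof.
move=> x0; rewrite /Rxyz !alphaE.
(* Scaling by [x] turns (1 : y/x), (y/x : z/x), (z/x : 1) into (x:y), (y:z), (z:x). *)
rewrite -(hval2Z _ 1 (y / x) x0) -(hval2Z _ (y / x) (z / x) x0).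
rewrite -(hval2Z _ (z / x) 1 x0) mulr1 !(mulrC x) !divfK //.
by rewrite (W0C _ x 1) (W0C _ y 1) (W0C _ z 1); ring.
Qed.

Lemma Rxyz_beta (R : realType) (p : nat) (x y z : 'F_p) (f : W0 R p) :
  x * y * z != 0 -> Rxyz x y z (beta f) = 0.
Proof.
rewrite !mulf_eq0 !negb_or -andbA => /and3P[x0 y0 z0].
have beta0 u v : u != 0 -> v != 0 -> hval3 (beta f) 1 u v = 0.
  move=> u0 v0; have [-> //] := betaE f 1 u v.
  by rewrite mul1r mulf_neq0.
by rewrite /Rxyz !beta0 ?mulf_neq0 ?invr_eq0 // !addr0 subr0.
Qed.

Theorem theorem3p2 (R : realType) (p : nat) (p_prime : prime p)
    (x y z : 'F_p) (xyz0 : x * y * z != 0) (g : W R p) :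
  Wnc g -> Rxyz x y z g = 0.
Proof.
have x0 : x != 0 by apply: contraNneq xyz0 => ->; rewrite !mul0r.
by case=> f1 [f2 ->]; rewrite linearD /= Rxyz_alpha // Rxyz_beta // addr0.
Qed.
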